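(* Let $q$ be a power of $2$. Let $V$ be a vector space of arbitrary even positive dimension $2t$ over $\mathbb{F}_q$ provided with a nondegenerate symplectic form $B$, and let $Q$ be a quadratic form on $V$ whose associated alternating bilinear form is $B$, i.e. $B(x,y)=Q(x+y)+Q(x)+Q(y)$ for all $x,y\in V$. Let $A$ be a subgroup of index $r>1$ in the additive group $\mathbb{F}_q^+$ of $\mathbb{F}_q$. Let the graphs $\Gamma(2t,q,A,r)$, $\Delta(2t,q,A,r,D)$ and $\Omega(2t,q,A,r,D)$ be as defined in the context. (1) If $D=\{A\}$, then the graph $\Gamma(2t,q,A,r)$ is isomorphic to $\Omega(2t,q,A,r,D)$. (2) If $D$ is a zero-free difference set in $\mathbb{F}_q^+/A$, then the graph $\Delta(2t,q,A,r,D)$ is isomorphic to $\Omega(2t,q,A,r,D)$.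
   Context: $\mathbb{F}_q^+$ denotes the additive group of $\mathbb{F}_q$. A symplectic form is an alternating bilinear form. Write $G=\mathbb{F}_q^+/A$; since $q$ is even, $G\times V$ is an elementary abelian $2$-group (of order $rq^{2t}$). The graph $\Gamma(2t,q,A,r)$ has vertex set $\{(\alpha+A,x) : \alpha\in\mathbb{F}_q,\ x\in V\}$, and two distinct vertices $(\alpha+A,x)$ and $(\beta+A,y)$ are adjacent if and only if $B(x,y)\in\alpha-\beta+A$. A $(v,k,\lambda)$ difference set in a group of order $v$ (written additively here) is a subset $D$ of size $k$ such that every non-identity element of the group can be expressed as a difference $d_1-d_2$ with $d_1,d_2\in D$ in exactly $\lambda$ ways; ''difference set'' means a $(v,k,\lambda)$ difference set for some $k,\lambda$, and trivial ones (such as $\{g\}$ and the complement of $\{g\}$) are allowed. A difference set in $\mathbb{F}_q^+/A$ is zero-free if it does not contain the identity element, i.e. the coset $A$. For a zero-free difference set $D=\{c_1+A,\ldots,c_K+A\}$ in $\mathbb{F}_q^+/A$ put $\widetilde{D}=(c_1+A)\cup\cdots\cup(c_K+A)\subseteq\mathbb{F}_q$. The graph $\Delta(2t,q,A,r,D)$ has vertex set $\{(\alpha+A,x) : \alpha\in\mathbb{F}_q,\ x\in V\}$, where $(\alpha+A,x)\sim(\beta+A,y)$ if and only if $B(x,y)\in\alpha-\beta+\widetilde{D}$. (As $q$ is even, $D=-D$ automatically.) For a group $H$ (written additively) and a subset $S\subseteq H$ with $S=-S$ not containing the identity, the Cayley graph $\operatorname{Cay}(H,S)$ has vertex set $H$,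 with $x,y$ adjacent if and only if $x-y\in S$. For $D$ equal to $\{A\}$ or to a zero-free difference set in $\mathbb{F}_q^+/A$, the graph $\Omega(2t,q,A,r,D)$ is the Cayley graph on the group $G\times V$ with connection set $$S=\{(\alpha+A,x)\in(G\times V)\setminus\{(A,0)\} : \alpha+Q(x)+A\in D\}.$$ *)

(* Defs.v *)
From HB Require Import structures.
From mathcomp Require Export all_boot all_order all_algebra.

Set Implicit Arguments.
Unset Strict Implicit.
Unset Printing Implicit Defensive.

Import GRing.Theory.
Local Open Scope ring_scope.
Local Open Scope quotient_scope.

Notation "{ 'quot' A }" := (Quotient.quot A)
  (format "{ 'quot'  A }") : type_scope.

HB.instance Definition _ (H : countZmodType) (A : zmodClosed H) :=
  isCountable.Build {quot A} (pcan_pickleK (can_pcan (@reprK _ {quot A}))).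
HB.instance Definition _ (H : finZmodType) (A : zmodClosed H) :=
  isFinite.Build {quot A} (pcan_enumP (can_pcan (@reprK _ {quot A}))).

Section DifferenceSets.
Variable H : finZmodType.

Definition vkl_difference_set (v k l : nat) (D : {set H}) : Prop :=
  [/\ #|H| = v, #|D| = k &
      forall g : H, g != 0 ->
        #|[set d : H * H | [&& d.1 \in D, d.2 \in D & d.1 - d.2 == g]]| = l].

Definition difference_set (D : {set H}) : Prop :=
  exists k l : nat, vkl_difference_set #|H| k l D.

Definition zero_free (D : {set H}) : bool := 0 \notin D.

End DifferenceSets.

Section Graphs.

(* A graph is given by its adjacency relation. *)
Definition graph_iso (T U : eqType) (e : rel T) (f : rel U) : Prop :=
  exists2 phi : T -> U, bijective phi & {mono phi : x y / e x y >-> f x y}.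

Definition cayley (H : zmodType) (S : {pred H}) : rel H :=
  fun x y => x - y \in S.

End Graphs.

Section Quadratic.
Variables (F : fieldType) (V : lmodType F).

Definition polar (Q : V -> F) (x y : V) : F := Q (x + y) - Q x - Q y.

Definition quadratic_form (Q : V -> F) : Prop :=
  (forall a x, Q (a *: x) = a ^+ 2 * Q x) /\ bilinear_for *%R *%R (polar Q).

End Quadratic.

(* In characteristic 2, is_psymplectic amounts to "alternating and
   nondegenerate"; an alternating form is always skew-symmetric, so taking B in
   {skew_symmetric V} loses no generality. *)
Lemma psymplectic_char2 (F : fieldType) (V : vectType F)
    (B : {skew_symmetric V}) (charF : 2 \in [pchar F]) :
  is_psymplectic B <->
  (forall x, B x x = 0) /\ (forall x, (forall y, B x y = 0) -> x = 0).
Proof.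
have radP x : reflect (forall y, B x y = 0) (x \in orthov B fullv).
  apply: (iffP mem_orthovP) => [h y|h y _]; last exact: h.
  by apply: h; rewrite memvf.
split=> [[/eqP rad0 _ alt]|[alt nd]].
  split=> [x|x xrad]; first exact: alt.
  by apply/eqP; rewrite -memv0 -rad0; apply/radP.
split=> //; rewrite /nondegenerate -subv0; apply/subvP=> x /radP xrad.
by rewrite memv0 (nd x xrad).
Qed.

(* Cosets of A are the elements of {quot A}: \pi_{quot A} a stands for a + A. *)
Section TheGraphs.
Variables (F : finFieldType) (V : vectType F) (A : zmodClosed F).

Definition Gamma (B : V -> V -> F) : rel ({quot A} * V) := fun u v =>
  (u != v) &&
  [exists a : F, exists b : F,
     [&& u.1 == \pi_{quot A} a, v.1 == \pi_{quot A} b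
       & B u.2 v.2 - (a - b) \in A]].

Definition coset_union (D : {set {quot A}}) : {set F} :=
  \bigcup_(c in D) [set a : F | \pi_{quot A} a == c].

Definition Delta (B : V -> V -> F) (D : {set {quot A}}) :
    rel ({quot A} * V) := fun u v =>
  [exists a : F, exists b : F,
     [&& u.1 == \pi_{quot A} a, v.1 == \pi_{quot A} b
       & B u.2 v.2 - (a - b) \in coset_union D]].

Definition Omega_conn (Q : V -> F) (D : {set {quot A}}) :
    pred ({quot A} * V) := fun g =>
  (g != 0) &&
  [exists a : F,
     (g.1 == \pi_{quot A} a) && (\pi_{quot A} (a + Q g.2) \in D)].

Definition Omega (Q : V -> F) (D : {set {quot A}}) : rel ({quot A} * V) :=
  cayley (Omega_conn Q D).

End TheGraphs.

(* Main.v *)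
Require Import Defs.
From mathcomp Require Import finfield.

Import GRing.Theory.
Local Open Scope ring_scope.

(** Put [c = \pi_{quot A}].  In characteristic 2 the polarization identity
    reads [B x y = Q x + Q y + Q (x - y)].  Hence the shear
    [(g, x) |-> (g + c (Q x), x)] of [{quot A} * V], whose inverse is
    [(g, x) |-> (g - c (Q x), x)], sends a pair of vertices [(g, x)], [(h, y)]
    to a pair whose difference [(k, x - y)] satisfies
    [k + c (Q (x - y)) = g - h + c (B x y)].  The left-hand side is what the
    connection set of [Omega] tests for membership in [D]; the right-hand side
    is what adjacency in [Gamma] (for [D = [set 0]]) and in [Delta] tests, once
    signs are dropped.  So one and the same map proves both isomorphisms
    ([shear_iso]).

    The only other point is loops: [Omega] and [Gamma] exclude them by
    definition, whereas [Delta] has none because [B] is alternating and [D] is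
    zero-free. *)

Section Cosets.
Set Implicit Arguments.
Unset Strict Implicit.
Variables (F : finFieldType) (V : vectType F) (A : zmodClosed F).
Implicit Types (D : {set {quot A}}) (u v : {quot A} * V).

Local Notation coset := (\pi_{quot A}%qT : F -> {quot A}).

Lemma coset_surj (g : {quot A}) : exists a, g = coset a.
Proof. by exists (repr g); rewrite reprK. Qed.

Lemma mem_coset_union D a : (a \in coset_union D) = (coset a \in D).
Proof.
apply/bigcupP/idP => [[c Dc]|Da]; first by rewrite inE => /eqP->.
by exists (coset a); rewrite ?inE.
Qed.

Lemma coset_eq0 a : (coset a == 0) = (a \in A).
Proof. by rewrite -[a in RHS]subr0 Quotient.idealrBE -[0 in LHS](raddf0 coset). Qed.

(** Adjacency is defined by choosing representatives of two cosets; the choice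
    is immaterial when the condition depends only on the cosets. *)
Lemma exists_repr2 (P : F -> F -> bool) (R : {quot A} -> {quot A} -> bool)
    (g h : {quot A}) :
  (forall a b, P a b = R (coset a) (coset b)) ->
  [exists a, exists b, [&& g == coset a, h == coset b & P a b]] = R g h.
Proof.
move=> PR; apply/existsP/idP => [[a /existsP[b]]|Rgh].
  by case/and3P=> /eqP-> /eqP->; rewrite PR.
have [[a ga] [b hb]] := (coset_surj g, coset_surj h).
exists a; apply/existsP; exists b.
by rewrite PR -ga -hb !eqxx.
Qed.

Lemma GammaE (B : V -> V -> F) u v :
  @Gamma F V A B u v =
  (u != v) && (coset (B u.2 v.2) - (u.1 - v.1) \in [set 0 : {quot A}]).
Proof.
congr (_ && _); apply: (exists_repr2 (R := fun g h =>
  coset (B u.2 v.2) - (g - h) \in [set 0])) => a b.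
by rewrite -!raddfB inE coset_eq0.
Qed.

Lemma DeltaE (B : V -> V -> F) D u v :
  Delta B D u v = (coset (B u.2 v.2) - (u.1 - v.1) \in D).
Proof.
apply: (exists_repr2 (R := fun g h =>
  coset (B u.2 v.2) - (g - h) \in D)) => a b.
by rewrite -!raddfB mem_coset_union.
Qed.

Lemma Omega_connE (Q : V -> F) D u :
  Omega_conn Q D u = (u != 0) && (u.1 + coset (Q u.2) \in D).
Proof.
congr (_ && _); apply/existsP/idP => [[a /andP[/eqP-> ]]|Du].
  by rewrite raddfD.
by have [a ua] := coset_surj u.1; exists a; rewrite raddfD /= -ua eqxx.
Qed.

Definition shear (Q : V -> F) u : {quot A} * V := (u.1 + coset (Q u.2), u.2).

Lemma shear_bij (Q : V -> F) : bijective (shear Q).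
Proof.
by exists (shear (fun x => - Q x)) => -[g x];
   rewrite /shear /= raddfN ?addrK ?subrK.
Qed.

(** A shear along any [Q] turns translation-invariant adjacency through [Q]
    into adjacency through [B], as soon as [B] is [Q] polarized with the signs
    proper to characteristic 2. *)
Lemma shear_iso (Q : V -> F) (B : V -> V -> F) D (e : rel ({quot A} * V)) :
    2 \in [pchar F] ->
    (forall x y, B x y = Q (x + y) + Q x + Q y) ->
    (forall u v,
       e u v = (u != v) && (coset (B u.2 v.2) - (u.1 - v.1) \in D)) ->
  graph_iso e (Omega Q D).
Proof.
move=> char2 BQ eE; exists (shear Q); first exact: shear_bij.
have oppV (x : V) : - x = x by rewrite -scaleN1r oppr_pchar2 ?scale1r.
have oppq (g : {quot A}) : - g = g.
  by have [a ->] := coset_surj g; rewrite -raddfN oppr_pchar2.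
move=> [g x] [h y].
rewrite eE /Omega /cayley [LHS]Omega_connE subr_eq0.
rewrite (bij_eq (shear_bij Q)) /= BQ !oppq oppV !raddfD /=.
congr (_ && (_ \in D)).
rewrite addrACA -[LHS]addrA [RHS]addrC; congr (_ + _).
by rewrite addrC addrA.
Qed.

End Cosets.

Theorem theorem4p1
    (q m : nat) (hq : q = (2 ^ m)%N)
    (F : finFieldType) (hF : #|F| = q)
    (t : nat) (t_gt0 : (0 < t)%N)
    (V : vectType F) (dimV : \dim {:V} = (2 * t)%N)
    (B : {skew_symmetric V}) (hB : is_psymplectic B)
    (Q : V -> F) (hQ : quadratic_form Q)
    (hQB : forall x y : V, B x y = Q (x + y) + Q x + Q y)
    (r : nat) (r_gt1 : (1 < r)%N)
    (A : zmodClosed F) (indexA : #|{: {quot A}}| = r) :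
  graph_iso (@Gamma F V A B) (@Omega F V A Q [set 0]) /\
  (forall D : {set {quot A}}, difference_set D -> zero_free D ->
     graph_iso (@Delta F V A B D) (@Omega F V A Q D)).
Proof.
have char2 : 2 \in [pchar F] by apply: (@card_finPcharP F 2 m); rewrite ?hF.
split=> [|D _ D0]; apply: (shear_iso char2 hQB) => u v; first exact: GammaE.
rewrite DeltaE; case: eqVneq => // ->; apply/negbTE.
have [_ _ alt] := hB.
by rewrite alt // subrr subr0 raddf0.
Qed.
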